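(* Let $n\ge 1$, let $\gamma\in\mathbb{R}$ be a parameter, and let $c_1,\dots,c_{2n}$ be real variables. Put $C_1=c_1+c_3+\cdots+c_{2n-1}$ and $C_2=c_2+c_4+\cdots+c_{2n}$, and for $0\le r\le n-1$ let $$I_r=\Psi^{1,2n-1}_{r-1}-C_2\,\Psi^{1,2n-2}_{r-1}-C_1\,\Psi^{2,2n-1}_{r-1}+\Psi^{2,2n-2}_{r-2}+(C_1C_2-\gamma)\,\Psi^{1,2n-1}_r .$$ Then for all $0\le r,s\le n-1$, $$\{I_r,I_s\}_c=0.$$
   Context: The multi-sum $\Psi$ is $$\Psi^{a,b}_r=\left(\ \sum_{\substack{a\le i_1,\ i_r\le b\\ i_j+1<i_{j+1}\ (1\le j<r)}}\ \prod_{j=1}^r \frac{1}{c_{i_j}c_{i_j+1}}\right)\prod_{i=a}^{b+1}c_i ,$$ which after cancellation is a polynomial in $c_a,\dots,c_{b+1}$ (the sum of all products obtained from $c_ac_{a+1}\cdots c_{b+1}$ by deleting $r$ pairwise disjoint pairs of adjacent factors). Conventions: $\Psi^{a,b}_0=\prod_{i=a}^{b+1}c_i$ (empty product equal to 1), $\Psi^{a,b}_r=0$ if $r<0$ or if the index set of the sum is empty with $r\ge1$. The Poisson bracket of differentiable functions $g,h$ of $c_1,\dots,c_{2n}$ is $$\{g,h\}_c=\sum_{i=1}^{2n-1}\left(\frac{\partial g}{\partial c_i}\frac{\partial h}{\partial c_{i+1}}-\frac{\partial g}{\partial c_{i+1}}\frac{\partial h}{\partial c_i}\right),$$ i.e.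 $\{c_i,c_{i+1}\}_c=1$ and $\{c_i,c_j\}_c=0$ for $|i-j|\neq 1$. *)

(* Defs.v *)
From mathcomp Require Import all_boot all_order all_algebra.
From mathcomp Require Import all_classical all_reals all_analysis.

Set Implicit Arguments.
Unset Strict Implicit.
Unset Printing Implicit Defensive.
Import Order.TTheory GRing.Theory Num.Theory.
Import numFieldNormedType.Exports.
Local Open Scope ring_scope.
Local Open Scope classical_set_scope.

(* Index sequences a <= i_1, i_j + 1 < i_(j+1), i_k <= b; the upper bound is
   carried by the type 'I_b.+1. *)
Definition admissible (a b k : nat) (t : k.-tuple 'I_b.+1) : bool :=
  all (fun i : 'I_b.+1 => (a <= i)%N) t &&
  sorted (fun i j : 'I_b.+1 => (i.+1 < j)%N) t.

(* The positions i_j and i_j + 1 of the cancelled factors. *)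
Definition deleted (b k : nat) (t : k.-tuple 'I_b.+1) : seq nat :=
  let s := [seq val i | i <- t] in s ++ [seq i.+1 | i <- s].

(* Psi is defined after cancellation of the denominators, so that it also makes
   sense when some c_i vanishes; Psi_quotient below recovers the quotient form. *)
Definition Psi (R : comNzRingType) (c : nat -> R) (a b : nat) (r : int) : R :=
  match r with
  | Posz k => \sum_(t : k.-tuple 'I_b.+1 | admissible a t)
                \prod_(a <= i < b.+2 | i \notin deleted t) c i
  | Negz _ => 0
  end.

Lemma Psi_quotient (F : fieldType) (c : nat -> F) (a b k : nat) :
  (forall i, (a <= i <= b.+1)%N -> c i != 0) ->
  Psi c a b k%:Z =
    (\sum_(t : k.-tuple 'I_b.+1 | admissible a t)
        \prod_(j < k) (1 / (c (tnth t j) * c (tnth t j).+1)))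
    * \prod_(a <= i < b.+2) c i.
Proof.
move=> c0; rewrite /Psi mulr_suml; apply: eq_bigr => t /andP[ta ts].
have jump_trans : transitive (fun i j : 'I_b.+1 => (i.+1 < j)%N).
  by move=> y x z xy yz; apply: leq_trans (ltnW yz); rewrite ltnS; apply: ltnW.
have pw := ts; rewrite (sorted_pairwise jump_trans) in pw.
have tab (i : 'I_b.+1) : i \in tval t -> (a <= i)%N.
  by move=> it; exact: (allP ta).
have ut : uniq [seq val i | i <- t].
  rewrite (map_inj_uniq val_inj) uniq_pairwise.
  by apply: sub_pairwise pw => i j /=; apply: contraTneq => ->; rewrite ltnNge leqnSn.
have ud : uniq (deleted t).
  rewrite /deleted cat_uniq ut (map_inj_uniq succn_inj) ut andbT /=.
  apply/hasPn => _ /mapP[_ /mapP[i it ->] ->]; apply/mapP => -[j jt ij].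
  have [[x y] [xlt ylt xi yj]] : exists p : nat * nat,
      [/\ (p.1 < size t)%N, (p.2 < size t)%N,
          nth i t p.1 = i & nth i t p.2 = j].
    by exists (index i t, index j t); rewrite !index_mem !nth_index.
  have pwn := pairwiseP i pw.
  case: (ltngtP x y) => xy.
  - have := pwn x y xlt ylt xy; rewrite xi yj /= -ij ltnn //.
  - have := pwn y x ylt xlt xy; rewrite xi yj /= -ij.
    by rewrite ltnNge ltnW // ltnW.
  - move: ij; rewrite -xi -yj xy => /eqP; rewrite /= eqn_leq ltnn //.
rewrite (bigID (fun i => i \in deleted t) xpredT) /= mulrA -[LHS]mul1r.
congr (_ * _).
rewrite -[X in _ * X]big_filter.
have pd : perm_eq [seq i <- index_iota a b.+2 | i \in deleted t] (deleted t).
  apply: uniq_perm => //; first by rewrite filter_uniq ?iota_uniq.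
  move=> i; rewrite mem_filter andb_idr // mem_cat.
  case/orP=> [/mapP[j jt ->]|/mapP[_ /mapP[j jt ->] ->]].
    rewrite mem_index_iota; apply/andP; split; first exact: tab.
    exact: ltnW (ltn_ord j).
  rewrite mem_index_iota; apply/andP; split; last by rewrite ltnS; exact: ltn_ord.
  exact: leq_trans (tab _ jt) (leqnSn _).
rewrite (perm_big _ pd) /= /deleted big_cat /= !big_map -big_split /=.
rewrite big_tuple -big_split /= big1 // => j _.
have aj := tab _ (mem_tnth j t); have jb := ltn_ord (tnth t j).
have cj : c (tnth t j) != 0 by apply: c0; rewrite aj ltnW.
have cj1 : c (tnth t j).+1 != 0 by apply: c0; rewrite (leq_trans aj (leqnSn _)).
by rewrite div1r mulVf // mulf_neq0.
Qed.

(* Coordinates of c = (c_1, ..., c_m) and basis vectors are numbered from 1. *)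
Definition coord (R : realType) (m : nat) (c : 'rV[R]_m) (i : nat) : R :=
  \sum_(j < m | j.+1 == i) c ord0 j.

Definition basis (R : realType) (m i : nat) : 'rV[R]_m :=
  \row_(j < m) (j.+1 == i)%:R.

Definition partial (R : realType) (m : nat) (i : nat) (g : 'rV[R]_m -> R)
    (c : 'rV[R]_m) : R := 'D_(basis R m i) g c.

Lemma partial_coord (R : realType) (m i j : nat) (c : 'rV[R]_m) :
  (1 <= j <= m)%N -> partial i (fun x => coord x j) c = (i == j)%:R.
Proof.
case: j => // j /= jm; rewrite /partial /derive.
have coordE (x : 'rV[R]_m) : coord x j.+1 = x ord0 (Ordinal jm).
  by rewrite /coord (big_pred1 (Ordinal jm)).
apply: cvg_lim => //.
apply: (@cvg_trans _ ((fun _ : R => (i == j.+1)%:R : R) @ 0^')); last exact: cvg_cst.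
apply: near_eq_cvg; near=> h.
have h0 : h != 0 by near: h; exact: nbhs_dnbhs_neq.
rewrite /= !coordE !mxE addrK; apply/esym; rewrite eq_sym.
exact: mulKf.
Unshelve. all: by end_near. Qed.

Definition bracket (R : realType) (m : nat) (g h : 'rV[R]_m -> R)
    (c : 'rV[R]_m) : R :=
  \sum_(1 <= i < m)
    (partial i g c * partial i.+1 h c - partial i.+1 g c * partial i h c).

Definition C1 (R : realType) (n : nat) (c : 'rV[R]_(2 * n)) : R :=
  \sum_(1 <= k < n.+1) coord c (2 * k - 1).

Definition C2 (R : realType) (n : nat) (c : 'rV[R]_(2 * n)) : R :=
  \sum_(1 <= k < n.+1) coord c (2 * k).

(* The upper limits 2 n - 1 and 2 n - 2 are truncated differences, which agree
   with the integer ones for 1 <= n. *)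
Definition I_ (R : realType) (n : nat) (gamma : R) (r : nat)
    (c : 'rV[R]_(2 * n)) : R :=
  let Psi_c := Psi (coord c) in
  Psi_c 1%N (2 * n - 1)%N (r%:Z - 1)
  - C2 c * Psi_c 1%N (2 * n - 2)%N (r%:Z - 1)
  - C1 c * Psi_c 2%N (2 * n - 1)%N (r%:Z - 1)
  + Psi_c 2%N (2 * n - 2)%N (r%:Z - 2)
  + (C1 c * C2 c - gamma) * Psi_c 1%N (2 * n - 1)%N r%:Z.

(* Main.v *)
(** The generating function [I(t) = \sum_r t^r I_r] involves only the continuants
    [A = K(1..2n)], [B = K(1..2n-1)], [C = K(2..2n)], [D = K(2..2n-1)] in [t],
    where [K(a..k+2) = c_(k+2) K(a..k+1) + t K(a..k)]:
      [I(t) = (C1 C2 - gamma + t) A - t C2 B - t C1 C + t^2 D].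
    The bracket [{c_i, c_(i+1)} = 1] gives these continuants a closed quadratic
    algebra: writing a prime for the value at a second parameter [u], all of
    [{A, A'}], [{B, B'}], [{C, C'}], [{D, D'}] vanish, and
      [(t - u) {A, B'} = A' B - A B'],   [(t - u) {C, D'} = C' D - C D'],
      [(t - u) {A, C'} = A C' - A' C],   [(t - u) {B, D'} = B D' - B' D],
      [(t - u) {A, D'} = B C' - B' C],   [(t - u) {B, C'} = A D' - A' D],
    by induction on the number of variables. Moreover [{C1, .}] and [- {C2, .}]
    act as the partial derivatives in [c_(2n)] and [c_1]. With these relations
    [{I(t), I(u)} = 0] is a polynomial identity, and comparing coefficients of
    [t^r u^s] gives the theorem. *)
From mathcomp Require Import all_boot all_order all_algebra.
From mathcomp Require Import all_classical all_reals all_analysis.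
From mathcomp Require Import zify ring.
Require Import Defs.

Set Implicit Arguments.
Unset Strict Implicit.
Unset Printing Implicit Defensive.
Import Order.TTheory GRing.Theory Num.Theory.
Import numFieldNormedType.Exports.
Local Open Scope ring_scope.

(** * Generating functions of [Psi] *)

(* The sequences of the definition of [Psi] with entries in [a, m), listed in
   decreasing order. *)
Fixpoint dimers (a m k : nat) : seq (seq nat) :=
  match k, m with
  | 0, _ => [:: [::]]
  | _, 0 => [::]
  | k'.+1, m'.+1 =>
      dimers a m' k ++
      (if (a <= m')%N then [seq m' :: s | s <- dimers a m'.-1 k'] else [::])
  end.

Lemma mem_dimers a m k s :
  (s \in dimers a m k) =
  [&& size s == k, all (fun i => a <= i < m)%N s
    & sorted (fun i j => j.+1 < i)%N s].
Proof.
have tr : transitive (fun i j => j.+1 < i)%N by move=> j i l /=; lia.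
elim/ltn_ind: m k s => -[|m] IH [|k] s.
- by rewrite inE; case: s.
- by case: s => [|i s] //=; rewrite ltn0 !andbF.
- by rewrite inE; case: s.
rewrite [dimers _ _ _]/= mem_cat IH //.
case: s => [|i s].
  by rewrite /=; case: ifP => // _; apply/negbTE/mapP => -[].
have -> : (i :: s \in (if (a <= m)%N then [seq m :: s | s <- dimers a m.-1 k]
            else [::])) = [&& (a <= m)%N, i == m & s \in dimers a m.-1 k].
  case: ifP => // am /=; apply/mapP/andP => [[s' s's [-> ->]]|[/eqP -> sk]] //.
  by exists s.
rewrite IH /=; last by case: (m) => //=.
rewrite eqSS; case: (size s == k) => //=; last by rewrite !andbF.
rewrite !(path_sortedE tr).
have sub : all (fun j => a <= j < m)%N s -> all (fun j => a <= j < m.+1)%N s.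
  by apply: sub_all => j; lia.
apply/idP/idP.
  case/orP => [/and3P[/andP[h1 h2] h3 h4]|/and4P[h1 /eqP -> h3 h4]].
    by rewrite sub //; move: h4 => ->; lia.
  have h : all (fun j => j.+1 < m)%N s by apply: sub_all h3 => j; lia.
  rewrite h h4 h1 ltnSn /= andbT; apply: sub_all h3 => j; lia.
case/and3P => [/andP[/andP[h1 h2] h3] h4 h5].
rewrite h4 h5 /= !andbT.
case: (ltngtP i m) => [im|im|im]; [|lia|].
  rewrite h1 /= andbF orbF; apply/allP => j js.
  by have := allP h3 j js; have := allP h4 j js; lia.
apply/orP; right; rewrite -im h1 /=.
by apply/allP => j js; have := allP h3 j js; have := allP h4 j js; lia.
Qed.

Lemma uniq_dimers a m k : uniq (dimers a m k).
Proof.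
elim/ltn_ind: m k => -[|m] IH [|k] //=.
rewrite cat_uniq IH //=; case: ifP => //= _.
rewrite map_inj_uniq; last by move=> ? ? [].
rewrite IH ?andbT; last by case: (m) => //=.
apply/hasPn => _ /mapP[s _ ->]; rewrite mem_dimers /= ltnn.
by rewrite !andbF.
Qed.

Lemma dimers_oversize a m k : (m < k)%N -> dimers a m k = [::].
Proof.
elim/ltn_ind: m k => -[|m] IH [|k] //= mk.
rewrite IH ?(ltnW mk) //; case: ifP => // _; rewrite IH //; lia.
Qed.

Section Psi.
#[local] Arguments Psi : simpl never.
Context {R : comNzRingType}.
Implicit Types (x : nat -> R) (t : R).

(** The monomer weight of a partial dimer covering of the path with vertices a, ..., m, where an
    entry i of [s] is the dimer on i and i + 1. The last vertex m is one more than the bound b of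
    [Psi]. *)
Definition cofactor_dimers x a m (s : seq nat) : R :=
  \prod_(a <= i < m.+1 | i \notin s ++ [seq i.+1 | i <- s]) x i.

(** Reversal matches the increasing admissible tuples bijectively with the decreasing lists of
    [dimers], which can be built by recursion on the last index. *)
Lemma Psi_dimers x a b k :
  Psi x a b k%:Z = \sum_(s <- dimers a b.+1 k) cofactor_dimers x a b.+1 s.
Proof.
pose f (t : k.-tuple 'I_b.+1) : seq nat := rev [seq val i | i <- t].
have -> : Psi x a b k%:Z =
    \sum_(t : k.-tuple 'I_b.+1 | admissible a t) cofactor_dimers x a b.+1 (f t).
  apply: eq_bigr => t _; apply: eq_bigl => i.
  by rewrite /deleted /f map_rev !mem_cat !mem_rev.
rewrite -[LHS]big_filter -(big_map f xpredT).
apply/perm_big/uniq_perm; last 1 first.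
- move=> s; rewrite mem_dimers; apply/mapP/and3P.
    move=> [t]; rewrite mem_filter => /andP[/andP[ta ts] _] ->; split.
    + by rewrite size_rev size_map size_tuple.
    + rewrite all_rev all_map; apply/allP => i it /=.
      by rewrite (allP ta) //=.
    + by rewrite /f rev_sorted sorted_map.
  move=> [/eqP sk sa ss].
  (* All entries of [s] are at most b, so [inord] inverts [val] on them. *)
  have sz : size [seq (inord i : 'I_b.+1) | i <- rev s] == k.
    by rewrite size_map size_rev sk.
  have vs : [seq val i | i <- [seq (inord i : 'I_b.+1) | i <- rev s]] = rev s.
    rewrite -map_comp -[RHS]map_id; apply/eq_in_map => i; rewrite mem_rev => si.
    by rewrite /= inordK //; have := allP sa i si; lia.
  exists (Tuple sz); last by rewrite /f vs revK.
  rewrite mem_filter mem_index_enum andbT /admissible /=; apply/andP; split.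
    have : all (fun i => a <= i)%N
        [seq val i | i <- [seq (inord i : 'I_b.+1) | i <- rev s]].
      by rewrite vs all_rev; apply: sub_all sa => i /andP[].
    by rewrite all_map.
  have : sorted (fun i j => i.+1 < j)%N
        [seq val i | i <- [seq (inord i : 'I_b.+1) | i <- rev s]].
    by rewrite vs rev_sorted.
  by rewrite sorted_map.
- rewrite map_inj_uniq ?filter_uniq ?index_enum_uniq //.
  move=> t t' /(can_inj revK)/(inj_map val_inj) tt'; exact: val_inj.
- exact: uniq_dimers.
Qed.

Lemma cofactor_dimers_cons x a m s : (a <= m.+1)%N ->
  all (fun i => i < m)%N s ->
  cofactor_dimers x a m.+2 (m.+1 :: s) = cofactor_dimers x a m s.
Proof.
move=> am /allP sm; rewrite /cofactor_dimers.
rewrite big_mkcond big_nat_recr ?(leqW am) //= big_nat_recr //=.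
rewrite !(inE, mem_cat) !eqxx !orbT /= !mulr1 [RHS]big_mkcond /=.
apply: eq_big_nat => i im; rewrite !(inE, mem_cat).
have -> : (i == m.+1) = false by lia.
by have -> : (i == m.+2) = false by lia.
Qed.

Lemma cofactor_dimers_recr x a m s : (a <= m.+1)%N ->
  all (fun i => i < m)%N s ->
  cofactor_dimers x a m.+1 s = x m.+1 * cofactor_dimers x a m s.
Proof.
move=> am /allP sm; rewrite /cofactor_dimers.
rewrite big_mkcond big_nat_recr //= -big_mkcond mulrC.
rewrite ifT // mem_cat negb_or; apply/andP; split.
  by apply/negP => /sm; lia.
by apply/mapP => -[i /sm im]; lia.
Qed.

Lemma dimers_ltn a m k s : s \in dimers a m k -> all (fun i => i < m)%N s.
Proof.
by rewrite mem_dimers => /and3P[_ sa _]; apply: sub_all sa => i /andP[].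
Qed.

Lemma dimersSS a m k : (a <= m.+1)%N ->
  dimers a m.+2 k.+1 =
  dimers a m.+1 k.+1 ++ [seq m.+1 :: s | s <- dimers a m k].
Proof. by move=> /= ->. Qed.

(** The vertex b + 3 is either free, which leaves the path up to b + 2, or covered by the dimer on b
    + 2 and b + 3, which leaves the path up to b + 1. *)
Lemma Psi_rec x a b k : (a <= b.+2)%N ->
  Psi x a b.+2 k.+1%:Z = x b.+3 * Psi x a b.+1 k.+1%:Z + Psi x a b k%:Z.
Proof.
move=> ab; rewrite !Psi_dimers dimersSS // big_cat big_map.
congr (_ + _).
  rewrite mulr_sumr; apply: eq_big_seq => s /dimers_ltn sm.
  by rewrite cofactor_dimers_recr // leqW.
apply: eq_big_seq => s /dimers_ltn sm.
by rewrite cofactor_dimers_cons.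
Qed.

Lemma Psi_rec0 x a b : (a <= b.+3)%N ->
  Psi x a b.+2 0%:Z = x b.+3 * Psi x a b.+1 0%:Z.
Proof.
by move=> ab; rewrite !Psi_dimers /= !big_seq1 cofactor_dimers_recr.
Qed.

Lemma Psi_oversize x a b k : (b.+1 < k)%N -> Psi x a b k%:Z = 0.
Proof. by move=> bk; rewrite Psi_dimers dimers_oversize // big_nil. Qed.

(** Euler's continuant recurrence with weight t for each deleted pair. The initial values stay free
    so that paths starting at 1 and at 2 are treated alike. *)
Fixpoint continuant x t (u0 u1 : R) (k : nat) : R :=
  match k with
  | 0 => u0
  | k1.+1 => if k1 is k2.+1
             then x k * continuant x t u0 u1 k1 + t * continuant x t u0 u1 k2
             else u1
  end.

Definition Psi_gf x a b N t : R := \sum_(k < N) t ^+ k * Psi x a b k%:Z.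

(** The factor t in the second term accounts for one dimer, so the truncation length there drops to
    [N]. *)
Lemma Psi_gf_rec x a b N t : (a <= b.+2)%N ->
  Psi_gf x a b.+2 N.+1 t = x b.+3 * Psi_gf x a b.+1 N.+1 t + t * Psi_gf x a b N t.
Proof.
move=> ab; rewrite /Psi_gf !big_ord_recl !expr0 !mul1r Psi_rec0; last lia.
rewrite mulrDr -addrA; congr (_ + _).
rewrite !mulr_sumr -big_split /=; apply: eq_bigr => k _.
by rewrite /bump /= add1n Psi_rec // exprS; ring.
Qed.

Lemma Psi_gf_oversize x a b N t : (b.+1 < N)%N ->
  Psi_gf x a b N t = Psi_gf x a b b.+2 t.
Proof.
move=> bN; rewrite /Psi_gf -(subnKC bN) big_split_ord /=.
rewrite [X in _ + X]big1 ?addr0 // => k _.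
by rewrite Psi_oversize ?mulr0 // leq_addr.
Qed.

(** The value [u0] belongs to the upper limit b = -1, which is not a natural number; it therefore
    enters through the recurrence at b = 1. *)
Lemma Psi_gf_continuant x a b N t u0 u1 :
  (a <= 2)%N -> (b.+1 < N)%N ->
  Psi_gf x a 0 2 t = u1 -> Psi_gf x a 1 3 t = x 2%N * u1 + t * u0 ->
  Psi_gf x a b N t = continuant x t u0 u1 b.+1.
Proof.
move=> a2 bN g0 g1; elim/ltn_ind: b N bN => -[|[|b]] IH [|N] bN //.
- by rewrite Psi_gf_oversize.
- by rewrite Psi_gf_oversize.
by rewrite Psi_gf_rec ?IH //; lia.
Qed.

Lemma Psi_gf1 x b N t : (b.+1 < N)%N ->
  Psi_gf x 1 b N t = continuant x t 1 (x 1%N) b.+1.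
Proof.
move=> bN; apply: Psi_gf_continuant => //;
  rewrite /Psi_gf !big_ord_recl big_ord0 !Psi_dimers;
  rewrite !(big_nil, big_cons) /cofactor_dimers /index_iota;
  rewrite !(big_nil, big_cons) /=; ring.
Qed.

Lemma Psi_gf2 x b N t : (b.+1 < N)%N ->
  Psi_gf x 2 b N t = continuant x t 0 1 b.+1.
Proof.
move=> bN; apply: Psi_gf_continuant => //;
  rewrite /Psi_gf !big_ord_recl big_ord0 !Psi_dimers;
  rewrite !(big_nil, big_cons) /cofactor_dimers /index_iota;
  rewrite !(big_nil, big_cons) /=; ring.
Qed.

Lemma Psi_gf_shift1 x a b N t :
  \sum_(r < N.+1) t ^+ r * Psi x a b (r%:Z - 1) = t * Psi_gf x a b N t.
Proof.
(* The term r = 0 is a [Psi] of negative order, which computes to 0. *)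
rewrite big_ord_recl mulr0 add0r /Psi_gf mulr_sumr.
apply: eq_bigr => r _; rewrite lift0 exprS mulrA; congr (_ * Psi _ _ _ _); lia.
Qed.

Lemma Psi_gf_shift2 x a b N t :
  \sum_(r < N.+2) t ^+ r * Psi x a b (r%:Z - 2) = t ^+ 2 * Psi_gf x a b N t.
Proof.
rewrite big_ord_recl mulr0 add0r expr2 -mulrA -Psi_gf_shift1 mulr_sumr.
apply: eq_bigr => r _; rewrite lift0 exprS mulrA; congr (_ * Psi _ _ _ _); lia.
Qed.

End Psi.

(** * Gradients and their pairing *)

(** Existence of all directional derivatives is enough for the sum and product rules of
    [partial]. *)
Definition gateaux (R : realType) (m : nat) (f : 'rV[R]_m -> R) : Prop :=
  forall c v, derivable f c v.

Section Gateaux.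
Context {R : realType} {m : nat}.
Implicit Types (f g : 'rV[R]_m -> R) (c : 'rV[R]_m).

Lemma gateaux_cst a : gateaux (fun _ : 'rV[R]_m => a).
Proof. by move=> c v; exact: derivable_cst. Qed.

Lemma gateauxD f g : gateaux f -> gateaux g -> gateaux (fun x => f x + g x).
Proof. by move=> df dg c v; apply: derivableD. Qed.

Lemma gateauxB f g : gateaux f -> gateaux g -> gateaux (fun x => f x - g x).
Proof. by move=> df dg c v; apply: derivableB. Qed.

Lemma gateauxM f g : gateaux f -> gateaux g -> gateaux (fun x => f x * g x).
Proof. by move=> df dg c v; apply: derivableM. Qed.

Lemma gateaux_sum (I : Type) (s : seq I) (P : pred I)
    (F : I -> 'rV[R]_m -> R) :
  (forall i, gateaux (F i)) -> gateaux (fun x => \sum_(i <- s | P i) F i x).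
Proof.
move=> dF; elim: s => [|i s IH].
  by under eq_fun do rewrite big_nil; exact: gateaux_cst.
under eq_fun do rewrite big_cons.
by case: (P i) => //; exact: gateauxD.
Qed.

Lemma gateaux_prod (I : Type) (s : seq I) (P : pred I)
    (F : I -> 'rV[R]_m -> R) :
  (forall i, gateaux (F i)) -> gateaux (fun x => \prod_(i <- s | P i) F i x).
Proof.
move=> dF; elim: s => [|i s IH].
  by under eq_fun do rewrite big_nil; exact: gateaux_cst.
under eq_fun do rewrite big_cons.
by case: (P i) => //; exact: gateauxM.
Qed.

Lemma gateaux_coord i : gateaux (fun x : 'rV[R]_m => coord x i).
Proof.
apply: gateaux_sum => j c v; apply: diff_derivable.
exact: differentiable_coord.
Qed.

Definition grad f c : nat -> R := fun i => partial i f c.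

Lemma grad_cst a c : grad (fun=> a) c = 0.
Proof. by apply/funext => i; exact: derive_cst. Qed.

Lemma gradD f g c : gateaux f -> gateaux g ->
  grad (fun x => f x + g x) c = grad f c + grad g c.
Proof. by move=> df dg; apply/funext => i; exact: deriveD. Qed.

Lemma gradM f g c : gateaux f -> gateaux g ->
  grad (fun x => f x * g x) c = f c *: grad g c + g c *: grad f c.
Proof. by move=> df dg; apply/funext => i; exact: deriveM. Qed.

Lemma gradZ a f c : gateaux f -> grad (fun x => a * f x) c = a *: grad f c.
Proof.
by move=> df; rewrite gradM ?grad_cst ?scaler0 ?addr0 //; exact: gateaux_cst.
Qed.

Lemma grad_sum (I : Type) (s : seq I) (P : pred I)
    (F : I -> 'rV[R]_m -> R) c :
  (forall i, gateaux (F i)) ->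
  grad (fun x => \sum_(i <- s | P i) F i x) c = \sum_(i <- s | P i) grad (F i) c.
Proof.
move=> dF; elim: s => [|i s IH].
  by rewrite big_nil; under eq_fun do rewrite big_nil; rewrite grad_cst.
rewrite big_cons; under eq_fun do rewrite big_cons.
case: (P i) => //; rewrite gradD ?IH //; exact: gateaux_sum.
Qed.

End Gateaux.

Section Pairing.
Context {R : realType} {m : nat}.
Implicit Types (g h : nat -> R) (c : 'rV[R]_m).

(** [bracket] unfolds to this form on two gradients, so computing brackets at a fixed point becomes
    bilinear algebra. *)
Definition pairing (g h : nat -> R) : R :=
  \sum_(1 <= i < m) (g i * h i.+1 - g i.+1 * h i).

Lemma pairingC g h : pairing g h = - pairing h g.
Proof. by rewrite /pairing -sumrN; apply: eq_bigr => i _; ring. Qed.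

Lemma pairingDl g1 g2 h : pairing (g1 + g2) h = pairing g1 h + pairing g2 h.
Proof.
by rewrite /pairing -big_split /=; apply: eq_bigr => i _; rewrite !fctE; ring.
Qed.

Lemma pairingZl a g h : pairing (a *: g) h = a * pairing g h.
Proof.
rewrite /pairing mulr_sumr; apply: eq_bigr => i _; rewrite !fctE.
by rewrite /GRing.scale /=; ring.
Qed.

Lemma pairing0l h : pairing 0 h = 0.
Proof. by rewrite -(scale0r 0) pairingZl mul0r. Qed.

Lemma pairingDr g h1 h2 : pairing g (h1 + h2) = pairing g h1 + pairing g h2.
Proof. by rewrite pairingC pairingDl opprD -!pairingC. Qed.

Lemma pairingZr a g h : pairing g (a *: h) = a * pairing g h.
Proof. by rewrite pairingC pairingZl -mulrN -pairingC. Qed.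

Lemma pairing0r g : pairing g 0 = 0.
Proof. by rewrite pairingC pairing0l oppr0. Qed.

Lemma pairing_suml (I : Type) (s : seq I) (P : pred I) (F : I -> nat -> R) h :
  pairing (\sum_(i <- s | P i) F i) h = \sum_(i <- s | P i) pairing (F i) h.
Proof.
elim/big_rec2: _ => [|i y x _ <-]; first exact: pairing0l.
exact: pairingDl.
Qed.

Lemma pairing_sumr (I : Type) (s : seq I) (P : pred I) (F : I -> nat -> R) g :
  pairing g (\sum_(i <- s | P i) F i) = \sum_(i <- s | P i) pairing g (F i).
Proof.
by rewrite pairingC pairing_suml -sumrN; apply: eq_bigr => i _; rewrite -pairingC.
Qed.

Lemma pairing_diag g : pairing g g = 0.
Proof. by apply: big1 => i _; ring. Qed.

Lemma pairing_coord c i j : (0 < i <= m)%N -> (0 < j <= m)%N ->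
  pairing (grad (fun x => coord x i) c) (grad (fun x => coord x j) c) =
  (j == i.+1)%:R - (i == j.+1)%:R.
Proof.
move=> im jm; rewrite /pairing.
transitivity (\sum_(1 <= k < m) ((k == i)%:R * (j == i.+1)%:R
                                 - (k == j)%:R * (i == j.+1)%:R) : R).
  apply: eq_bigr => k _; rewrite /grad !partial_coord // -!natrM !mulnb.
  congr (_%:R - _%:R); lia.
rewrite sumrB -!mulr_suml.
have S l : (0 < l <= m)%N -> (\sum_(1 <= k < m) (k == l)%:R : R) = (l < m)%:R.
  move=> lm; rewrite -natr_sum -big_mkcond /=; congr _%:R.
  have [lm'|lm'] := ltnP l m.
    rewrite big_nat1_eq ifT //; lia.
  rewrite big_nat1_eq ifF //; lia.
(* The sum [S] loses the index l = m, but then the other factor would need a coordinate numbered m +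
   1, so it vanishes too. *)
rewrite !S // -!natrM !mulnb; congr (_%:R - _%:R); lia.
Qed.

End Pairing.

Arguments pairing {R} m g h.

(** * The bracket algebra of continuants *)

Section ContinuantBrackets.
Context {R : realType} {m : nat}.
Implicit Types (c : 'rV[R]_m) (t u : R).

(* [contK t k] and [contE t k] are the continuants of [c_1, ..., c_k] and of
   [c_2, ..., c_k]; the value [contE t 0 = 0] continues the recurrence. *)
Definition contK t k : 'rV[R]_m -> R :=
  fun c => continuant (coord c) t 1 (coord c 1%N) k.

Definition contE t k : 'rV[R]_m -> R :=
  fun c => continuant (coord c) t 0 1 k.

Definition dcoord c (i : nat) : nat -> R := grad (fun x => coord x i) c.

(** Collects the properties of [contK] and [contE] on which the bracket inductions rest. Initial
    values are independent of the parameter, and the last clause covers both U_1 = c_1 with U_0 = 1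
    and U_1 = 1 with U_0 = 0. *)
Definition continuant_family (U : R -> nat -> 'rV[R]_m -> R) : Prop :=
  [/\ forall t k c, U t k.+2 c = coord c k.+2 * U t k.+1 c + t * U t k c,
      forall t, gateaux (U t 0%N) /\ gateaux (U t 1%N),
      forall t c, grad (U t 0%N) c = 0,
      forall t u c, U t 0%N c = U u 0%N c /\ U t 1%N c = U u 1%N c
    & forall t c, grad (U t 1%N) c = U t 0%N c *: dcoord c 1].

Lemma contK_family : continuant_family contK.
Proof.
split=> //.
- by split; [exact: gateaux_cst | exact: gateaux_coord].
- by move=> t c; exact: grad_cst.
- by move=> t c; rewrite scale1r.
Qed.

Lemma contE_family : continuant_family contE.
Proof.
split=> //.
- by split; exact: gateaux_cst.
- by move=> t c; exact: grad_cst.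
- by move=> t c; rewrite scale0r; exact: grad_cst.
Qed.

Section Family.
Context (U : R -> nat -> 'rV[R]_m -> R) (famU : continuant_family U).

Lemma family_fun t k : U t k.+2 =
  (fun c => coord c k.+2 * U t k.+1 c + t * U t k c).
Proof. by case: famU => rec _ _ _ _; apply/funext => c; exact: rec. Qed.

Lemma gateaux_family t k : gateaux (U t k).
Proof.
case: famU => _ g01 _ _ _.
elim/ltn_ind: k => -[|[|k]] IH; [exact: (g01 t).1|exact: (g01 t).2|].
rewrite family_fun; apply: gateauxD.
  by apply: gateauxM; [exact: gateaux_coord|exact: IH].
by apply: gateauxM; [exact: gateaux_cst|exact: IH].
Qed.

Lemma grad_family t k c : grad (U t k.+2) c =
  coord c k.+2 *: grad (U t k.+1) c + U t k.+1 c *: dcoord c k.+2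
  + t *: grad (U t k) c.
Proof.
rewrite {1}family_fun gradD; last 2 first.
- by apply: gateauxM; [exact: gateaux_coord|exact: gateaux_family].
- by apply: gateauxM; [exact: gateaux_cst|exact: gateaux_family].
congr (_ + _); first exact: gradM _ (@gateaux_coord _ _ _) (@gateaux_family _ _).
exact: gradZ _ _ (@gateaux_family _ _).
Qed.

(** U_k involves only c_1, ..., c_k, so among later coordinates it meets only c_(k+1), through its
    derivative in c_k, which is U_(k-1). *)
Lemma pairing_family_coord t k j c : (k < j <= m)%N ->
  pairing m (grad (U t k) c) (dcoord c j) =
  if k is k'.+1 then (j == k.+1)%:R * U t k' c else 0.
Proof.
case: (famU) => _ _ g0 _ g1.
elim/ltn_ind: k j => -[|[|k]] IH j kj.
- by rewrite g0 pairing0l.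
- rewrite g1 pairingZl pairing_coord; try lia.
  by case: j kj => // j _; rewrite subr0 mulrC.
rewrite grad_family !pairingDl !pairingZl !IH ?pairing_coord; try lia.
have -> : (j == k.+2) = false by lia.
have -> : (k.+2 == j.+1) = false by lia.
case: k IH kj => [|k] IH kj /=; first by ring.
have -> : (j == k.+2) = false by lia.
by rewrite /=; ring.
Qed.

Lemma pairing_family_last t k c : (k.+1 < m)%N ->
  [/\ pairing m (grad (U t k.+1) c) (dcoord c k.+2) = U t k c,
     pairing m (dcoord c k.+2) (grad (U t k.+1) c) = - U t k c,
     pairing m (grad (U t k) c) (dcoord c k.+2) = 0
   & pairing m (dcoord c k.+2) (grad (U t k) c) = 0].
Proof.
move=> km; have Uc : pairing m (grad (U t k.+1) c) (dcoord c k.+2) = U t k c.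
  by rewrite pairing_family_coord ?eqxx ?mul1r //; lia.
have Uc0 : pairing m (grad (U t k) c) (dcoord c k.+2) = 0.
  rewrite pairing_family_coord; last lia.
  by case: (k) => // k'; rewrite (_ : (_ == _) = false) ?mul0r //; lia.
by split; rewrite // pairingC ?Uc ?Uc0 ?oppr0.
Qed.

(** The three relations are carried through one induction. With a prime for the parameter u and Q =
    U'_(k+1) U_k - U_(k+1) U'_k, the bracket of U_(k+2) and U'_(k+2) gets c_(k+2) Q from the
    brackets with c_(k+2) and c_(k+2) (u - t) Q / (t - u) from the mixed ones; these cancel. *)
Lemma bracket_same_family t u k c : t != u -> (k < m)%N ->
  [/\ pairing m (grad (U t k) c) (grad (U u k) c) = 0,
     pairing m (grad (U t k.+1) c) (grad (U u k.+1) c) = 0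
   & (t - u) * pairing m (grad (U t k.+1) c) (grad (U u k) c) =
     U u k.+1 c * U t k c - U t k.+1 c * U u k c].
Proof.
case: (famU) => rec _ g0 E01 g1.
elim: k t u => [|k IH] t u tu km.
  rewrite !g1 !g0 !pairing0r pairingZl pairingZr pairing_diag !mulr0; split=> //.
  by have [-> ->] := E01 t u c; ring.
have [I0 Ia Ib] := IH t u tu (ltnW km).
(* Exchanging the parameters gives, by antisymmetry, the other mixed bracket {U_k, U'_(k+1)}. *)
have [_ _ Ib'] := IH u t ltac:(by rewrite eq_sym) (ltnW km).
have tu0 : t - u != 0 by rewrite subr_eq0.
have {}Ib : pairing m (grad (U t k.+1) c) (grad (U u k) c) =
  (U u k.+1 c * U t k c - U t k.+1 c * U u k c) / (t - u).
  by rewrite -Ib mulrC mulKf.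
have {}Ib' : pairing m (grad (U t k) c) (grad (U u k.+1) c) =
  (U t k.+1 c * U u k c - U u k.+1 c * U t k c) / (t - u).
  rewrite pairingC; apply: (mulIf tu0); rewrite mulfVK //.
  rewrite mulNr mulrC -mulNr opprB Ib'; ring.
have [Uc _ Uc0 _] := pairing_family_last t c km.
have [_ cU _ cU0] := pairing_family_last u c km.
split=> //.
  rewrite !grad_family !(pairingDl, pairingDr, pairingZl, pairingZr).
  rewrite pairing_diag Ia Ib Ib' I0 Uc cU Uc0 cU0.
  move: (U t k c) (U u k c) (U t k.+1 c) (U u k.+1 c) (coord c k.+2) => a b d e f.
  by field.
rewrite !grad_family !(pairingDl, pairingDr, pairingZl, pairingZr).
rewrite Ia Ib' cU !rec.
move: (U t k c) (U u k c) (U t k.+1 c) (U u k.+1 c) (coord c k.+2) => a b d e f.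
by field.
Qed.
End Family.

(** Same induction, but with distinct families antisymmetry does not link the two mixed brackets, so
    each has its own relation. At k = 0 both sides vanish, since the initial values do not depend on
    the parameter. *)
Lemma bracket_two_families U V t u k c :
  continuant_family U -> continuant_family V -> t != u -> (k < m)%N ->
  [/\ (t - u) * pairing m (grad (U t k) c) (grad (V u k) c) =
       U t k c * V u k c - U u k c * V t k c,
     (t - u) * pairing m (grad (U t k.+1) c) (grad (V u k.+1) c) =
       U t k.+1 c * V u k.+1 c - U u k.+1 c * V t k.+1 c,
     (t - u) * pairing m (grad (U t k.+1) c) (grad (V u k) c) =
       U t k c * V u k.+1 c - U u k c * V t k.+1 c
   & (t - u) * pairing m (grad (U t k) c) (grad (V u k.+1) c) =
       U t k.+1 c * V u k c - U u k.+1 c * V t k c].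
Proof.
move=> famU famV tu.
case: (famU) (famV) => recU _ gU0 EU gU1 [recV _ gV0 EV gV1].
have tu0 : t - u != 0 by rewrite subr_eq0.
elim: k => [|k IH] km.
  rewrite !gU1 !gV1 !gU0 !gV0 !(pairing0r, pairing0l) pairingZl pairingZr.
  rewrite pairing_diag !mulr0.
  by have [-> ->] := EU t u c; have [-> ->] := EV t u c; split=> //; ring.
have [I00 I11 I10 I01] := IH (ltnW km).
have [Uc _ Uc0 _] := pairing_family_last famU t c km.
have [_ cV _ cV0] := pairing_family_last famV u c km.
have div a b : (t - u) * a = b -> a = b / (t - u).
  by move=> <-; rewrite mulrC mulKf.
(* [I11] is already the first relation for k + 1, so it is kept beside its divided form. *)
move/div in I00; move/div in I01; move/div in I10; move/div: (I11) => J11.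
split=> //;
  rewrite ?(grad_family famU) ?(grad_family famV);
  rewrite !(pairingDl, pairingDr, pairingZl, pairingZr) ?pairing_diag;
  rewrite ?I00 ?J11 ?I01 ?I10 ?Uc ?Uc0 ?cV ?cV0 ?recU ?recV;
  move: (U t k c) (U u k c) (U t k.+1 c) (U u k.+1 c) (coord c k.+2) => a b d e f;
  move: (V t k c) (V u k c) (V t k.+1 c) (V u k.+1 c) => a' b' d' e';
  by field.
Qed.

End ContinuantBrackets.

(** * Brackets with the odd and even coordinate sums *)

Section OddEvenSums.
Context {R : realType} {n : nat}.
Implicit Types (c : 'rV[R]_(2 * n)) (t u : R).

Lemma gateaux_C1 : gateaux (@C1 R n).
Proof. by apply: gateaux_sum => k; exact: gateaux_coord. Qed.

Lemma gateaux_C2 : gateaux (@C2 R n).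
Proof. by apply: gateaux_sum => k; exact: gateaux_coord. Qed.

(** An even coordinate before c_(2n) has two odd neighbours, contributing opposite signs; c_(2n) has
    only one. Hence the telescoping sum. *)
Lemma pairing_C1_coord c j : (0 < j <= 2 * n)%N ->
  pairing (2 * n) (grad (@C1 R n) c) (dcoord c j) = (j == 2 * n)%:R.
Proof.
move=> jn; rewrite /C1 grad_sum; last by move=> k; exact: gateaux_coord.
rewrite pairing_suml big_add1 /=.
transitivity (\sum_(0 <= k < n) ((j == 2 * k.+1)%:R - (j == 2 * k)%:R) : R).
  apply: eq_big_nat => k kn; rewrite pairing_coord //; last lia.
  congr (_%:R - _%:R); lia.
rewrite (telescope_sumr (fun k => (j == 2 * k)%N%:R)) //.
rewrite (_ : (j == 2 * 0)%N = false) ?subr0 //; lia.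
Qed.

(** Here the coordinate with a single even neighbour is c_1, and {c_2, c_1} = -1. *)
Lemma pairing_C2_coord c j : (0 < j <= 2 * n)%N ->
  pairing (2 * n) (grad (@C2 R n) c) (dcoord c j) = - (j == 1%N)%:R.
Proof.
move=> jn; rewrite /C2 grad_sum; last by move=> k; exact: gateaux_coord.
rewrite pairing_suml big_add1 /=.
transitivity (\sum_(0 <= k < n) ((j == (2 * k.+1).+1)%:R - (j == (2 * k).+1)%:R) : R).
  apply: eq_big_nat => k kn; rewrite pairing_coord //; last lia.
  congr (_%:R - _%:R); lia.
rewrite (telescope_sumr (fun k => (j == (2 * k).+1)%:R)) //.
rewrite (_ : (j == (2 * n).+1) = false) ?sub0r //; lia.
Qed.

Lemma pairing_C1_C2 c : (0 < n)%N ->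
  pairing (2 * n) (grad (@C1 R n) c) (grad (@C2 R n) c) = 1.
Proof.
move=> n0; rewrite /C2 grad_sum; last by move=> k; exact: gateaux_coord.
rewrite pairing_sumr big_nat_recr //= big_nat big1 ?add0r => [|k kn].
  by rewrite pairing_C1_coord ?eqxx //; lia.
rewrite pairing_C1_coord; last lia.
by rewrite (_ : (2 * k == 2 * n)%N = false) //; lia.
Qed.

(** For k < 2n the function U_k does not involve c_(2n), the only coordinate with nonzero bracket
    with [C1]. *)
Lemma pairing_C1_family U t k c : continuant_family U -> (k < 2 * n)%N ->
  pairing (2 * n) (grad (@C1 R n) c) (grad (U t k) c) = 0.
Proof.
move=> famU; case: (famU) => _ _ g0 _ g1.
elim/ltn_ind: k => -[|[|k]] IH kn.
- by rewrite g0 pairing0r.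
- rewrite g1 pairingZr pairing_C1_coord; last lia.
  by rewrite (_ : (_ == _) = false) ?mulr0 //; lia.
rewrite (grad_family famU) !pairingDr !pairingZr !IH ?pairing_C1_coord; try lia.
by rewrite (_ : (_ == _) = false) ?mulr0 ?addr0 //; lia.
Qed.

Lemma pairing_C1_family_last U t k c : continuant_family U -> k.+2 = (2 * n)%N ->
  pairing (2 * n) (grad (@C1 R n) c) (grad (U t k.+2) c) = U t k.+1 c.
Proof.
move=> famU kn; rewrite (grad_family famU) !pairingDr !pairingZr.
rewrite !pairing_C1_family ?pairing_C1_coord //; try lia.
by rewrite kn eqxx /=; ring.
Qed.

Lemma pairing_C2_contE t k c : (k <= 2 * n)%N ->
  pairing (2 * n) (grad (@C2 R n) c) (grad (contE t k) c) = 0.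
Proof.
case: (contE_family (R := R) (m := 2 * n)) => _ _ g0 _ g1.
elim/ltn_ind: k => -[|[|k]] IH kn.
- by rewrite g0 pairing0r.
- by rewrite g1 pairingZr mul0r.
rewrite (grad_family contE_family) !pairingDr !pairingZr !IH; try lia.
rewrite pairing_C2_coord; last lia.
by rewrite /=; ring.
Qed.

(** The derivative in c_1 removes c_1 from the continuant of c_1, ..., c_k; the convention
    [contE t 0 = 0] covers k = 0. *)
Lemma pairing_C2_contK t k c : (k <= 2 * n)%N ->
  pairing (2 * n) (grad (@C2 R n) c) (grad (contK t k) c) = - contE t k c.
Proof.
case: (contK_family (R := R) (m := 2 * n)) => _ _ g0 _ g1.
elim/ltn_ind: k => -[|[|k]] IH kn.
- by rewrite g0 pairing0r oppr0.
- rewrite g1 pairingZr pairing_C2_coord /=; last lia.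
  by rewrite /contE /contK /=; ring.
rewrite (grad_family contK_family) !pairingDr !pairingZr !IH; try lia.
rewrite pairing_C2_coord; last lia.
by case: (contE_family (R := R) (m := 2 * n)) => -> _ _ _ _ /=; ring.
Qed.

End OddEvenSums.

(** * Involution *)

(** A polynomial of degree below N with the N distinct roots 0, 1, ..., N - 1 is zero. *)
Lemma coefficients_eq0 (R : numDomainType) N (a : nat -> R) :
  (forall t, \sum_(r < N) t ^+ r * a r = 0) -> forall r, (r < N)%N -> a r = 0.
Proof.
move=> a0 r rN; pose p := \poly_(i < N) a i.
have p0 : p = 0.
  apply: (@roots_geq_poly_eq0 _ p [seq i%:R | i <- iota 0 N]).
  - apply/allP => _ /mapP[i _ ->]; rewrite rootE horner_poly.
    by rewrite -[X in _ == X](a0 i%:R); apply/eqP/eq_bigr => k _; rewrite mulrC.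
  - rewrite map_inj_uniq ?iota_uniq // => i j /eqP; rewrite eqr_nat => /eqP //.
  - by rewrite size_map size_iota size_poly.
by have := coef_poly N a r; rewrite -/p p0 coef0 rN.
Qed.

(** * The generating function of the [I_] and its brackets *)

Section GeneratingFunction.
#[local] Arguments Psi : simpl never.
Context {R : realType} {n : nat}.
Implicit Types (c : 'rV[R]_(2 * n)) (t u gamma : R).

(** Signs are absorbed into the factors [- t], so that the gradient follows from the sum, product
    and scaling rules. *)
Definition I_gf gamma t c : R :=
  (C1 c * C2 c + (t - gamma)) * contK t (2 * n) c
  + (- t * (C2 c * contK t (2 * n).-1 c)
     + (- t * (C1 c * contE t (2 * n) c) + t ^+ 2 * contE t (2 * n).-1 c)).

Lemma grad_I_gf gamma t c : grad (I_gf gamma t) c =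
  (C1 c * C2 c + (t - gamma)) *: grad (contK t (2 * n)) c
  + contK t (2 * n) c *: (C1 c *: grad (@C2 R n) c + C2 c *: grad (@C1 R n) c)
  + (- t *: (C2 c *: grad (contK t (2 * n).-1) c
             + contK t (2 * n).-1 c *: grad (@C2 R n) c)
     + (- t *: (C1 c *: grad (contE t (2 * n)) c
                + contE t (2 * n) c *: grad (@C1 R n) c)
        + t ^+ 2 *: grad (contE t (2 * n).-1) c)).
Proof.
have dK k : gateaux (@contK R (2 * n) t k) :=
  @gateaux_family _ _ _ contK_family t k.
have dE k : gateaux (@contE R (2 * n) t k) :=
  @gateaux_family _ _ _ contE_family t k.
have d1 := @gateaux_C1 R n.
have d2 := @gateaux_C2 R n.
have d0 a := @gateaux_cst R (2 * n) a.
rewrite /I_gf gradD; last 2 first.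
- apply: (gateauxM _ (dK _)); apply: (gateauxD _ (d0 _)); exact: gateauxM.
- apply: gateauxD; first exact: gateauxM (d0 _) (gateauxM d2 (dK _)).
  apply: gateauxD; first exact: gateauxM (d0 _) (gateauxM d1 (dE _)).
  exact: gateauxM (d0 _) (dE _).
congr (_ + _).
  rewrite gradM; [|by apply: (gateauxD _ (d0 _)); exact: gateauxM|exact: dK].
  rewrite gradD; [|exact: gateauxM|exact: d0].
  by rewrite grad_cst addr0 gradM.
rewrite gradD; last 2 first.
- exact: gateauxM (d0 _) (gateauxM d2 (dK _)).
- apply: gateauxD; first exact: gateauxM (d0 _) (gateauxM d1 (dE _)).
  exact: gateauxM (d0 _) (dE _).
congr (_ + _).
  by rewrite (gradZ _ _ (gateauxM d2 (dK _))) (gradM _ d2 (dK _)).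
rewrite gradD; last 2 first.
- exact: gateauxM (d0 _) (gateauxM d1 (dE _)).
- exact: gateauxM (d0 _) (dE _).
congr (_ + _).
  by rewrite (gradZ _ _ (gateauxM d1 (dE _))) (gradM _ d1 (dE _)).
by rewrite (gradZ _ _ (dE _)).
Qed.

Lemma pairing_I_gf gamma t u c : (0 < n)%N -> t != u ->
  pairing (2 * n) (grad (I_gf gamma t) c) (grad (I_gf gamma u) c) = 0.
Proof.
move=> n0 tu; have [k kn] : exists k, k.+2 = (2 * n)%N.
  by exists (2 * n.-1)%N; lia.
have tu0 : t - u != 0 by rewrite subr_eq0.
have ut : u != t by rewrite eq_sym.
have kn' : (k.+1 < 2 * n)%N by lia.
have div a b : (t - u) * a = b -> a = b / (t - u).
  by move=> <-; rewrite mulrC mulKf.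
have swap (g h : nat -> R) (a : R) :
    pairing (2 * n) g h = a -> pairing (2 * n) h g = - a.
  by move=> <-; exact: pairingC.
have [KK0 KK1 /div KK10] := bracket_same_family contK_family c tu kn'.
have [EE0 EE1 /div EE10] := bracket_same_family contE_family c tu kn'.
have [_ _ KK01] := bracket_same_family contK_family c ut kn'.
have [_ _ EE01] := bracket_same_family contE_family c ut kn'.
have [/div KE0 /div KE1 /div KE10 /div KE01] :=
  bracket_two_families c contK_family contE_family tu kn'.
have [/div EK0 /div EK1 /div EK10 /div EK01] :=
  bracket_two_families c contE_family contK_family tu kn'.
(* The relation with t and u exchanged, turned around by antisymmetry. *)
have {}KK01 : pairing (2 * n) (grad (contK t k.+1) c) (grad (contK u k.+2) c) =
  (contK t k.+2 c * contK u k.+1 c - contK u k.+2 c * contK t k.+1 c) / (t - u).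
  by apply: div; rewrite pairingC mulrN -mulNr opprB KK01; ring.
have {}EE01 : pairing (2 * n) (grad (contE t k.+1) c) (grad (contE u k.+2) c) =
  (contE t k.+2 c * contE u k.+1 c - contE u k.+2 c * contE t k.+1 c) / (t - u).
  by apply: div; rewrite pairingC mulrN -mulNr opprB EE01; ring.
have C1K1 v := pairing_C1_family_last v c contK_family kn.
have C1E1 v := pairing_C1_family_last v c contE_family kn.
have C1K0 v := pairing_C1_family v c contK_family kn'.
have C1E0 v := pairing_C1_family v c contE_family kn'.
have C2K1 v := @pairing_C2_contK R n v k.+2 c ltac:(lia).
have C2E1 v := @pairing_C2_contE R n v k.+2 c ltac:(lia).
have C2K0 v := @pairing_C2_contK R n v k.+1 c ltac:(lia).
have C2E0 v := @pairing_C2_contE R n v k.+1 c ltac:(lia).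
have C12 := pairing_C1_C2 c n0.
have E : ((2 * n).-1 = k.+1)%N by lia.
(* The number 2n also occurs in the type of [c], so only the index is changed, by congruence. *)
have EK v : @contK R (2 * n) v (2 * n) = contK v k.+2 :=
  congr1 (contK v) (esym kn).
have EE v : @contE R (2 * n) v (2 * n) = contE v k.+2 :=
  congr1 (contE v) (esym kn).
rewrite !grad_I_gf E !EK !EE.
have wDl := @pairingDl R (2 * n); have wDr := @pairingDr R (2 * n).
have wZl := @pairingZl R (2 * n); have wZr := @pairingZr R (2 * n).
have w0 := @pairing_diag R (2 * n).
have C1K1t := C1K1 t; have C1K1u := C1K1 u; clear C1K1.
have C1K0t := C1K0 t; have C1K0u := C1K0 u; clear C1K0.
have C1E1t := C1E1 t; have C1E1u := C1E1 u; clear C1E1.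
have C1E0t := C1E0 t; have C1E0u := C1E0 u; clear C1E0.
have C2K1t := C2K1 t; have C2K1u := C2K1 u; clear C2K1.
have C2K0t := C2K0 t; have C2K0u := C2K0 u; clear C2K0.
have C2E1t := C2E1 t; have C2E1u := C2E1 u; clear C2E1.
have C2E0t := C2E0 t; have C2E0u := C2E0 u; clear C2E0.
clear EK EE.
(* Rewriting with bilinearity is only fast on opaque vectors. *)
remember (pairing (2 * n)) as w eqn:Hw; clear Hw.
repeat match goal with |- context [grad ?f c] =>
  let v := fresh "v" in let Hv := fresh in
  remember (grad f c) as v eqn:Hv; clear Hv
end.
rewrite !(wDl, wZl) !(wDr, wZr) !w0.
rewrite KK0 KK1 KK10 KK01 EE0 EE1 EE10 EE01 KE0 KE1 KE10 KE01 EK0 EK1 EK10 EK01.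
rewrite ?C1K1u ?(swap _ _ _ C1K1t).
rewrite ?C1K0u ?(swap _ _ _ C1K0t).
rewrite ?C1E1u ?(swap _ _ _ C1E1t).
rewrite ?C1E0u ?(swap _ _ _ C1E0t).
rewrite ?C2K1u ?(swap _ _ _ C2K1t).
rewrite ?C2K0u ?(swap _ _ _ C2K0t).
rewrite ?C2E1u ?(swap _ _ _ C2E1t).
rewrite ?C2E0u ?(swap _ _ _ C2E0t).
rewrite C12 (swap _ _ _ C12).
move: (contK t k.+2 c) (contK u k.+2 c) (contK t k.+1 c) (contK u k.+1 c).
move: (contE t k.+2 c) (contE u k.+2 c) (contE t k.+1 c) (contE u k.+1 c).
move: (C1 c) (C2 c) => p q e e' d d' a a' b b'.
(* What remains is a rational identity in eight continuant values, [C1], [C2] and the parameters,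
   with denominators t - u. *)
by field.
Qed.

(* [I_ r] vanishes for [r > n + 1], so any longer range of summation would do. *)
Lemma I_gfE gamma t c : (0 < n)%N ->
  \sum_(r < (2 * n).+3) t ^+ r * I_ gamma r c = I_gf gamma t c.
Proof.
move=> n0; have [k kn] : exists k, k.+2 = (2 * n)%N.
  by exists (2 * n.-1)%N; lia.
have e1 : (2 * n - 1 = k.+1)%N by lia.
have e2 : (2 * n - 2 = k)%N by lia.
pose x := coord c.
(* Each shift of the order of [Psi] by one shortens the common range 2n + 3 by one. *)
transitivity (t * Psi_gf x 1 k.+1 (2 * n).+2 t
  - C2 c * (t * Psi_gf x 1 k (2 * n).+2 t)
  - C1 c * (t * Psi_gf x 2 k.+1 (2 * n).+2 t)
  + t ^+ 2 * Psi_gf x 2 k (2 * n).+1 t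
  + (C1 c * C2 c - gamma) * Psi_gf x 1 k.+1 (2 * n).+3 t).
  rewrite -!Psi_gf_shift1 -Psi_gf_shift2 /Psi_gf.
  under eq_bigr do rewrite /I_ e1 e2 -/x.
  move: (C1 c) (C2 c) => p q; move: (p * q - gamma) => w.
  rewrite !mulr_sumr -!sumrB -!big_split /=; apply: eq_bigr => r _; ring.
rewrite !Psi_gf1 ?Psi_gf2; try lia.
have e3 : (2 * n).-1 = k.+1 by lia.
have cE u0 u1 : continuant x t u0 u1 (2 * n) = continuant x t u0 u1 k.+2 :=
  congr1 (continuant x t u0 u1) (esym kn).
rewrite /I_gf /contK /contE -/x e3 !cE; ring.
Qed.

Lemma gateaux_Psi m a b z : gateaux (fun c : 'rV[R]_m => Psi (coord c) a b z).
Proof.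
case: z => k; last exact: gateaux_cst.
by apply: gateaux_sum => s; apply: gateaux_prod => i; exact: gateaux_coord.
Qed.

Lemma gateaux_I gamma r : gateaux (@I_ R n gamma r).
Proof.
have dP := gateaux_Psi; have d1 := @gateaux_C1 R n; have d2 := @gateaux_C2 R n.
apply: gateauxD.
  apply: gateauxD; last exact: dP.
  apply: gateauxB; last exact: gateauxM d1 (dP _ _ _ _).
  by apply: gateauxB; [exact: dP|exact: gateauxM d2 (dP _ _ _ _)].
apply: gateauxM; last exact: dP.
by apply: gateauxB; [exact: gateauxM|exact: gateaux_cst].
Qed.

End GeneratingFunction.

Theorem theorem12 (R : realType) (n : nat) (hn : (1 <= n)%N) (gamma : R)
    (r s : nat) (hr : (r <= n - 1)%N) (hs : (s <= n - 1)%N)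
    (c : 'rV[R]_(2 * n)) :
  bracket (@I_ R n gamma r) (@I_ R n gamma s) c = 0%R.
Proof.
pose N := (2 * n).+3.
pose g i := grad (@I_ R n gamma i) c.
have gI t : grad (I_gf gamma t) c = \sum_(i < N) t ^+ i *: g i.
  have -> : I_gf gamma t =
      fun x : 'rV[R]_(2 * n) => \sum_(i < N) t ^+ i * I_ gamma i x.
    by apply/funext => x; rewrite I_gfE.
  rewrite grad_sum => [|i]; last first.
    exact: gateauxM (@gateaux_cst _ _ _) (@gateaux_I _ _ _ _).
  by apply: eq_bigr => i _; rewrite gradZ //; exact: gateaux_I.
have rN : (r < N)%N by rewrite /N; lia.
have sN : (s < N)%N by rewrite /N; lia.
(* Coefficients are extracted first in u, at index s, then in t, at index r, leaving the bracket of
   the two generating functions. *)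
apply: (@coefficients_eq0 _ N (fun j => pairing (2 * n) (g r) (g j))) sN => u.
apply: (@coefficients_eq0 _ N
  (fun i => \sum_(j < N) u ^+ j * pairing (2 * n) (g i) (g j))) rN => t.
transitivity (pairing (2 * n) (grad (I_gf gamma t) c) (grad (I_gf gamma u) c)).
  rewrite !gI pairing_suml; apply: eq_bigr => i _.
  rewrite pairingZl pairing_sumr; congr (_ * _).
  by apply: eq_bigr => j _; rewrite pairingZr.
(* The relations divided by t - u say nothing at t = u, where antisymmetry suffices. *)
have [->|tu] := eqVneq t u; first exact: pairing_diag.
exact: pairing_I_gf.
Qed.
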